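(* Let $(S,d)$ be a complete separable metric space, let $\rho>0$, and let \[ M:=\{\mu\in\mathcal{M}(S):\|\mu\|_{\mathrm{TV}}=\rho\}. \] Then for every $\mu\in M$ and every $\varepsilon>0$ there exist (finitely many) nonempty compact sets $K_1,\dots,K_n\subset S$ such that for $K=\bigcup_{i=1}^nK_i$: (i) $|\mu|(S\setminus K)<\varepsilon$; (ii) there exists $0<\lambda_0\le\varepsilon$ such that for all $0<\lambda\le\lambda_0$ there exist $\delta_1,\dots,\delta_n>0$ such that: if $\nu\in M$ satisfies $|\langle\mu-\nu,h_{\lambda,K_i}\rangle|<\delta_i$ for all $i=1,\dots,n$, then $|\nu|(S\setminus K^\lambda)<\varepsilon$. In particular, the relative $\sigma(\mathcal{M}(S),\mathrm{BL}(S))$-weak topology and the relative $\|\cdot\|_{\mathrm{BL}}^*$-norm topology on $M$ coincide.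
   Context: $\mathcal{M}(S)$ is the space of finite signed Borel measures on $S$ and $\langle\mu,f\rangle:=\int_S f\,d\mu$; $|\mu|$ is the total variation measure and $\|\mu\|_{\mathrm{TV}}:=|\mu|(S)$. $\mathrm{BL}(S)$ is the space of bounded real-valued Lipschitz functions on $(S,d)$ with norm $\|f\|_{\mathrm{BL}}:=\|f\|_\infty+|f|_L$, where $|f|_L:=\sup\{|f(x)-f(y)|/d(x,y):x\neq y\}$. The $\sigma(\mathcal{M}(S),\mathrm{BL}(S))$-weak topology is the coarsest topology on $\mathcal{M}(S)$ making $\mu\mapsto\langle\mu,f\rangle$ continuous for every $f\in\mathrm{BL}(S)$. The dual bounded Lipschitz norm is $\|\mu\|_{\mathrm{BL}}^*:=\sup\{|\langle\mu,f\rangle|:f\in\mathrm{BL}(S),\ \|f\|_{\mathrm{BL}}\le1\}$. For nonempty $A\subset S$ and $\lambda>0$, $A^\lambda:=\{x\in S:d(x,A)\le\lambda\}$. For $\lambda>0$ and $C\subset S$ closed and nonempty, $h_{\lambda,C}(x):=[1-\frac1\lambda d(x,C)]^+$, where $[t]^+=\max(t,0)$. *)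

(* Defs.v *)
From HB Require Import structures.
From mathcomp Require Import all_boot all_order all_algebra.
From mathcomp Require Import all_classical all_reals all_analysis.

Set Implicit Arguments.
Unset Strict Implicit.
Unset Printing Implicit Defensive.

Import Order.TTheory GRing.Theory Num.Theory.
Import numFieldNormedType.Exports.

Local Open Scope classical_set_scope.
Local Open Scope ring_scope.

(* The library's complete and measurable types are pointed, so this structure
   excludes the empty metric space, which carries no signed measure of total
   variation rho > 0. *)
#[short(type="completeMetricType")]
HB.structure Definition CompleteMetric (R : numDomainType) :=
  {T of Complete T & Metric R T}.

Definition separable (T : topologicalType) :=
  exists2 D : set T, countable D & dense D.

Definition relatively_open (T : topologicalType) (M : set T)
    (U : set (set_type M)) := open U.
Arguments relatively_open : clear implicits.

Section charge.
Context d (T : measurableType d) (R : realType).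
Implicit Types mu nu : {charge set T -> \bar R}.

Lemma hahn_exists mu :
  exists PN : set T * set T, hahn_decomposition mu PN.1 PN.2.
Proof. by have [P [N PN]] := Hahn_decomposition mu; exists (P, N). Qed.

(* By Hahn_decomposition_uniq, the Jordan parts obtained from the chosen pair
   do not depend on the choice. *)
Definition hahn_pair mu : set T * set T := projT1 (cid (hahn_exists mu)).

Definition hahn_pairP mu :
    hahn_decomposition mu (hahn_pair mu).1 (hahn_pair mu).2 :=
  projT2 (cid (hahn_exists mu)).

Definition tv_measure mu : {measure set T -> \bar R} :=
  charge_variation (hahn_pairP mu).

Definition pairing mu (f : T -> R) : R :=
  \int[jordan_pos (hahn_pairP mu)]_x f x
  - \int[jordan_neg (hahn_pairP mu)]_x f x.

Definition csub mu nu : {charge set T -> \bar R} := cadd mu (copp nu).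

End charge.

Section metric.
Context (R : realType) (S : metricType R).
Implicit Types (f : S -> R) (A C : set S) (lam : R).

(* Only meaningful for A nonempty, as inf set0 = 0. *)
Definition dist_set A (x : S) : R := inf [set mdist x a | a in A].

Definition thickening A lam : set S := [set x | dist_set A x <= lam].

Definition hat lam C (x : S) : R :=
  Num.max (1 - lam^-1 * dist_set C x) 0.

Definition BL : set (S -> R) :=
  [set f | (exists B, forall x, `|f x| <= B) /\
           (exists L, forall x y, `|f x - f y| <= L * mdist x y)].

Definition sup_norm f : R := sup [set `|f x| | x in [set: S]].

Definition lip_const f : R :=
  sup [set `|f p.1 - f p.2| / mdist p.1 p.2 | p in [set p | p.1 <> p.2]].

Definition BL_norm f : R := sup_norm f + lip_const f.

End metric.

Section measure_space.
Context (R : realType) (S : completeMetricType R).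

Definition borel := g_sigma_algebraType (@open S).

(* Charges are functions on all subsets, with arbitrary values outside the
   Borel sets. Total variation, pairing and both topologies below only see the
   Borel sets, so charges that agree there are topologically
   indistinguishable. *)
Definition signed_measure : Type := {charge set borel -> \bar R}.

HB.instance Definition _ := gen_eqMixin signed_measure.
HB.instance Definition _ := gen_choiceMixin signed_measure.

Definition BL_dual_norm (mu : signed_measure) : R :=
  sup [set `|pairing mu f| | f in [set f | BL f /\ BL_norm (f : S -> R) <= 1]].

(* The coarsest topology making every pairing with a function of BL
   continuous. *)
Definition weak_measures : topologicalType :=
  sup_topology (fun f : set_type (@BL R S) =>
    Topological.on
      (initial_topology (fun mu : signed_measure => pairing mu (\val f)))).

Definition BL_dual_measures : Type := signed_measure.

Definition BL_dual_open (U : set BL_dual_measures) :=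
  forall mu, U mu -> exists2 e : R, 0 < e &
    forall nu : BL_dual_measures, BL_dual_norm (csub mu nu) < e -> U nu.

Let BL_dual_openT : BL_dual_open setT.
Proof. by move=> mu _; exists 1. Qed.

Let BL_dual_openI : setI_closed BL_dual_open.
Proof.
move=> U V oU oV mu [/oU[e e0 eU] /oV[e' e'0 eV]].
exists (Num.min e e'); first by rewrite lt_min e0.
by move=> nu; rewrite lt_min => /andP[/eU ? /eV].
Qed.

Let BL_dual_open_bigU (I : Type) (f : I -> set BL_dual_measures) :
  (forall i, BL_dual_open (f i)) -> BL_dual_open (\bigcup_i f i).
Proof.
by move=> of_ mu [i _ /of_[e e0 ef]]; exists e => // nu /ef; exists i.
Qed.

HB.instance Definition _ := Choice.on BL_dual_measures.
HB.instance Definition _ := isOpenTopological.Build BL_dual_measures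
  BL_dual_openT BL_dual_openI BL_dual_open_bigU.

Definition tv_sphere (rho : R) : set signed_measure :=
  [set mu | tv_measure mu setT = rho%:E].

End measure_space.

Arguments tv_sphere {R} S rho.

(* Main.v *)
Require Import Defs.
From HB Require Import structures.
From mathcomp Require Import all_boot all_order all_algebra.
From mathcomp Require Import all_classical all_reals all_analysis.
From mathcomp Require Import measurable_realfun lra.

Set Implicit Arguments.
Unset Strict Implicit.
Unset Printing Implicit Defensive.

Import Order.TTheory GRing.Theory Num.Theory.
Import numFieldNormedType.Exports.

Local Open Scope classical_set_scope.
Local Open Scope ring_scope.

(** Let [mu] have total variation [rho], and let [P], [N] be its Hahn sets. Finite
    Borel measures on a complete separable metric space are inner regular for
    compact sets ([compact_inner]), so there are compact sets [K1] inside [P] and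
    [K2] inside [N] that carry all but a small part of [|mu|]. These disjoint
    compacts are at positive distance, hence for small [lam] the difference [g] of
    their hats equals the sign of [mu] on [K1] and [K2], and [<mu, g>] is almost
    [rho]. Since [|g| <= 1] and [g] vanishes off the thickening, any [nu] of the
    same total variation [rho] for which [<nu, g>] is close to [<mu, g>] has almost
    all its mass on the thickening ([hat_test], [concentration]). The total
    variation is not weakly continuous; fixing its value is what makes this work.

    For the topologies, each pairing with a bounded Lipschitz function is
    Lipschitz for the dual norm, so weakly open sets are norm open
    ([weak_open_dual_open]). Conversely, the thickening of a compact set is covered
    by finitely many balls of radius comparable to [lam]. A Lipschitz partition of
    unity subordinate to them approximates every [f] of the unit ball, uniformly
    within [4 * lam] on the thickening, by a combination of finitely many fixed
    functions with coefficients the values of [f] at the centres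
    ([interpolant_error]). Off the thickening [mu] and, by concentration, [nu] have
    little mass. Hence closeness of [mu] and [nu] on the hats and on the
    finitely many functions of the partition bounds [<mu - nu, f>] uniformly in [f]
    ([near_dual_norm]). This replaces a compactness argument for the unit ball. *)

(** * Pairings and total variation of signed measures *)

Section pairing.
Context d (T : measurableType d) (R : realType).
Implicit Types (mu nu : {charge set T -> \bar R}) (f g : T -> R) (A : set T).

Definition bounded_measurable f : Prop :=
  measurable_fun setT f /\ exists B, forall x, `|f x| <= B.

Lemma bounded_measurable_integrable (m : {measure set T -> \bar R}) f :
  (m setT < +oo)%E -> bounded_measurable f -> m.-integrable setT (EFin \o f).
Proof.
move=> moo [mf [B fB]]; apply: measurable_bounded_integrable => //.
exists B; split; first exact: num_real.
by move=> M BM x _; apply: le_trans (fB x) (ltW BM).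
Qed.

Lemma bounded_measurable_integrable_finite
    (m : {finite_measure set T -> \bar R}) f :
  bounded_measurable f -> m.-integrable setT (EFin \o f).
Proof.
by apply: bounded_measurable_integrable; rewrite ltey_eq fin_num_measure.
Qed.

Lemma bounded_measurableD f g : bounded_measurable f -> bounded_measurable g ->
  bounded_measurable (fun x => f x + g x).
Proof.
move=> [mf [B fB]] [mg [C gC]]; split; first exact: measurable_funD.
by exists (B + C) => x; rewrite (le_trans (ler_normD _ _))// lerD.
Qed.

Lemma bounded_measurableZ (a : R) f : bounded_measurable f ->
  bounded_measurable (fun x => a * f x).
Proof.
move=> [mf [B fB]]; split; first exact: measurable_funM.
by exists (`|a| * B) => x; rewrite normrM ler_wpM2l.
Qed.

Lemma bounded_measurableB f g : bounded_measurable f -> bounded_measurable g ->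
  bounded_measurable (fun x => f x - g x).
Proof.
move=> [mf [B fB]] [mg [C gC]]; split; first exact: measurable_funB.
by exists (B + C) => x; rewrite (le_trans (ler_normB _ _))// lerD.
Qed.

Lemma bounded_measurable_indic A : measurable A ->
  bounded_measurable (\1_A : T -> R).
Proof.
move=> mA; split; first exact: measurable_indic.
exists 1 => x; rewrite indicE ger0_norm ?ler0n//.
by case: (_ \in _); rewrite ?ler01.
Qed.

Lemma pairingD mu f g : bounded_measurable f -> bounded_measurable g ->
  pairing mu (fun x => f x + g x) = pairing mu f + pairing mu g.
Proof.
move=> bf bg; rewrite /pairing !RintegralD//;
  by [exact: bounded_measurable_integrable_finite|lra].
Qed.

Lemma pairingB mu f g : bounded_measurable f -> bounded_measurable g ->
  pairing mu (fun x => f x - g x) = pairing mu f - pairing mu g.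
Proof.
move=> bf bg; rewrite /pairing !RintegralB//;
  by [exact: bounded_measurable_integrable_finite|lra].
Qed.

Lemma pairingZ mu (a : R) f : bounded_measurable f ->
  pairing mu (fun x => a * f x) = a * pairing mu f.
Proof.
move=> bf; rewrite /pairing !RintegralZl//;
  by [exact: bounded_measurable_integrable_finite|lra].
Qed.

Lemma pairing0 mu : pairing mu (fun=> 0) = 0.
Proof. by rewrite /pairing !Rintegral_cst// !mul0r subrr. Qed.

Lemma integral_measure_addR (m1 m2 : {measure set T -> \bar R}) f :
  (m1 setT < +oo)%E -> (m2 setT < +oo)%E -> bounded_measurable f ->
  \int[measure_add m1 m2]_x f x = \int[m1]_x f x + \int[m2]_x f x.
Proof.
move=> m1oo m2oo bf.
have i1 := bounded_measurable_integrable m1oo bf.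
have i2 := bounded_measurable_integrable m2oo bf.
rewrite /Rintegral integral_measure_add//.
by rewrite fineD//; exact: integrable_fin_num.
Qed.

(** The Hahn decomposition of [mu - nu] is unrelated to those of [mu] and [nu],
    but [(mu - nu)^+ + mu^- + nu^+ = (mu - nu)^- + mu^+ + nu^-] as measures, and
    integrals are additive in the measure. *)
Lemma pairing_csub mu nu f : bounded_measurable f ->
  pairing (csub mu nu) f = pairing mu f - pairing nu f.
Proof.
move=> bf.
pose Jp (s : {charge set T -> \bar R}) := jordan_pos (hahn_pairP s) :
  {finite_measure set T -> \bar R}.
pose Jn (s : {charge set T -> \bar R}) := jordan_neg (hahn_pairP s) :
  {finite_measure set T -> \bar R}.
have JE (s : {charge set T -> \bar R}) A : measurable A ->
    s A = (Jp s A - Jn s A)%E.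
  by move=> mA; rewrite (jordan_decomp (hahn_pairP s) mA)/= /cadd/= cscaleN1.
have key : \int[measure_add (Jp (csub mu nu)) (measure_add (Jn mu) (Jp nu))]_x f x
   = \int[measure_add (Jn (csub mu nu)) (measure_add (Jp mu) (Jn nu))]_x f x.
  rewrite /Rintegral; congr fine.
  apply: eq_measure_integral => A mA _.
  have addE (a b c : {finite_measure set T -> \bar R}) :
      measure_add a (measure_add b c) A = (a A + (b A + c A))%E.
    by transitivity (a A + measure_add b c A)%E;
      [exact: measure_addE|congr (_ + _)%E; exact: measure_addE].
  transitivity (Jp (csub mu nu) A + (Jn mu A + Jp nu A))%E; first exact: addE.
  transitivity (Jn (csub mu nu) A + (Jp mu A + Jn nu A))%E; last first.
    by apply/esym; exact: addE.
  have := JE (csub mu nu) _ mA.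
  rewrite [csub mu nu A]/(mu A - nu A)%E (JE mu _ mA) (JE nu _ mA).
  rewrite -(fineK (fin_num_measure (Jp mu) _ mA)).
  rewrite -(fineK (fin_num_measure (Jn mu) _ mA)).
  rewrite -(fineK (fin_num_measure (Jp nu) _ mA)).
  rewrite -(fineK (fin_num_measure (Jn nu) _ mA)).
  rewrite -(fineK (fin_num_measure (Jp (csub mu nu)) _ mA)).
  rewrite -(fineK (fin_num_measure (Jn (csub mu nu)) _ mA)).
  by move=> /eqP; rewrite -!EFinD eqe => /eqP h; congr EFin; move: h; lra.
have addE (a b c : {finite_measure set T -> \bar R}) :
  \int[measure_add a (measure_add b c)]_x f x =
  \int[a]_x f x + (\int[b]_x f x + \int[c]_x f x).
  have fin (m : {finite_measure set T -> \bar R}) : (m setT < +oo)%E.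
    by rewrite ltey_eq fin_num_measure.
  have bc : (measure_add b c setT < +oo)%E.
    apply: (@le_lt_trans _ _ (b setT + c setT)%E); last exact: lte_add_pinfty.
    by rewrite le_eqVlt; apply/orP; left; apply/eqP; exact: measure_addE.
  rewrite (integral_measure_addR (fin a) bc bf); congr (_ + _).
  exact: (integral_measure_addR (fin b) (fin c) bf).
by move: key; rewrite !addE /pairing -/(Jp _) -/(Jn _) -/(Jp _) -/(Jn _); lra.
Qed.

Lemma tv_measure_fin mu A : measurable A -> tv_measure mu A \is a fin_num.
Proof.
by move=> mA; rewrite /tv_measure/= fin_numD !fin_num_measure.
Qed.

(** The total variation is finite on measurable sets, so its real-valued form
    loses nothing and lets estimates be closed by linear arithmetic. *)
Definition tvr mu A : R := fine (tv_measure mu A).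

Lemma tvrE mu A : measurable A ->
  tvr mu A = fine (jordan_pos (hahn_pairP mu) A) +
             fine (jordan_neg (hahn_pairP mu) A).
Proof. by move=> mA; rewrite /tvr /tv_measure/= fineD ?fin_num_measure. Qed.

Lemma tvrK mu A : measurable A -> (tvr mu A)%:E = tv_measure mu A.
Proof. by move=> mA; rewrite fineK// tv_measure_fin. Qed.

Lemma tvr_ge0 mu A : 0 <= tvr mu A.
Proof. by rewrite fine_ge0. Qed.

Lemma le_tvr mu A B : measurable A -> measurable B -> A `<=` B ->
  tvr mu A <= tvr mu B.
Proof.
by move=> mA mB AB; rewrite -lee_fin !tvrK// le_measure// inE.
Qed.

Lemma tvrC mu A : measurable A -> tvr mu A + tvr mu (~` A) = tvr mu setT.
Proof.
move=> mA; apply/eqP; rewrite -eqe EFinD !tvrK//; last exact: measurableC.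
by rewrite -measureU ?setUCr ?setICr//; exact: measurableC.
Qed.

(** Every upper estimate of a pairing below is an instance of this one, with [A]
    a set that carries most of the mass and [a] small there, or with [A]
    the region outside which [f] vanishes. *)
Lemma pairing_le_split mu f A (a b : R) : measurable A -> bounded_measurable f ->
  (forall x, A x -> `|f x| <= a) -> (forall x, ~ A x -> `|f x| <= b) ->
  `|pairing mu f| <= a * tvr mu A + b * tvr mu (~` A).
Proof.
move=> mA bf fa fb; have mCA := measurableC mA.
have one (m : {finite_measure set T -> \bar R}) :
    `|\int[m]_x f x| <= a * fine (m A) + b * fine (m (~` A)).
  (* The step function with values [a] on [A] and [b] off [A] dominates [|f|]. *)
  pose g x := a * \1_A x + b * \1_(~` A) x.
  have bA := bounded_measurable_indic mA.
  have bCA := bounded_measurable_indic mCA.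
  have bg : bounded_measurable g.
    by apply: bounded_measurableD; apply: bounded_measurableZ.
  have gE : \int[m]_x g x = a * fine (m A) + b * fine (m (~` A)).
    rewrite /g RintegralD//; [|exact/bounded_measurable_integrable_finite/bounded_measurableZ..].
    rewrite !RintegralZl//; [|exact/bounded_measurable_integrable_finite..].
    by rewrite /Rintegral !integral_indic// !setIT.
  rewrite -gE (le_trans (le_normr_Rintegral _ _))//.
    exact: bounded_measurable_integrable_finite.
  apply: le_Rintegral => //; [|exact: bounded_measurable_integrable_finite|].
    apply: bounded_measurable_integrable_finite; case: bf => mf [B fB].
    split; first exact: measurableT_comp.
    by exists B => x; rewrite normr_id.
  move=> x _; rewrite /g !indicE in_setC.
  have [/set_mem Ax|/negP/= nAx] := boolP (x \in A).
    by rewrite mulr1 mulr0 addr0; exact: fa.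
  by rewrite mulr1 mulr0 add0r; apply: fb => Ax; apply/nAx/mem_set.
rewrite /pairing (le_trans (ler_normB _ _))// !tvrE//.
have := one (jordan_pos (hahn_pairP mu)); have := one (jordan_neg (hahn_pairP mu)).
lra.
Qed.

Lemma pairing_le mu f (a : R) : bounded_measurable f ->
  (forall x, `|f x| <= a) -> `|pairing mu f| <= a * tvr mu setT.
Proof.
move=> bf fa; have := pairing_le_split mu measurableT bf (fun x _ => fa x)
  (b := 0) (fun x nx => False_ind _ (nx I)).
by rewrite mul0r addr0.
Qed.

Lemma hahn_pair_measurable mu :
  measurable (hahn_pair mu).1 /\ measurable (hahn_pair mu).2.
Proof. by have [[mP _] [mN _] _ _] := hahn_pairP mu. Qed.

Lemma hahn_pair_cover mu x : (hahn_pair mu).1 x \/ (hahn_pair mu).2 x.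
Proof.
have [_ _ PN _] := hahn_pairP mu.
by have : [set: T] x by []; rewrite -PN.
Qed.

Lemma hahn_pair_disj mu x : (hahn_pair mu).1 x -> (hahn_pair mu).2 x -> False.
Proof.
have [_ _ _ PN] := hahn_pairP mu => Px Nx.
by have : ((hahn_pair mu).1 `&` (hahn_pair mu).2) x by []; rewrite PN.
Qed.

(** Each Jordan part is carried by its own Hahn set. *)
Lemma pairing_sign mu :
  pairing mu (fun x => \1_(hahn_pair mu).1 x - \1_(hahn_pair mu).2 x) =
  tvr mu setT.
Proof.
have [mP mN] := hahn_pair_measurable mu.
have bP := bounded_measurable_indic mP.
have bN := bounded_measurable_indic mN.
rewrite /pairing !RintegralB//; [|exact/bounded_measurable_integrable_finite..].
rewrite /Rintegral !integral_indic// !setIT tvrE//.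
have [_ _ PNT PN0] := hahn_pairP mu.
have posE A : measurable A ->
    jordan_pos (hahn_pairP mu) A = mu (A `&` (hahn_pair mu).1).
  by move=> mA; rewrite jordan_posE cjordan_posE /crestr0 mem_set.
have negE A : measurable A ->
    jordan_neg (hahn_pairP mu) A = (- mu (A `&` (hahn_pair mu).2))%E.
  by move=> mA; rewrite jordan_negE cjordan_negE /crestr0 mem_set.
rewrite /= !posE// !negE// !setTI !setIid PN0 setIC PN0 charge0 oppe0/=.
lra.
Qed.

(** A function bounded by 1 that agrees with the sign of [mu] off a small set
    almost attains the total variation. *)
Lemma pairing_ge_sign mu f A : measurable A -> bounded_measurable f ->
  (forall x, `|f x| <= 1) ->
  (forall x, A x -> (hahn_pair mu).1 x -> f x = 1) ->
  (forall x, A x -> (hahn_pair mu).2 x -> f x = -1) ->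
  tvr mu setT - 2 * tvr mu (~` A) <= pairing mu f.
Proof.
move=> mA bf f1 fP fN; have [mP mN] := hahn_pair_measurable mu.
pose s x : R := \1_(hahn_pair mu).1 x - \1_(hahn_pair mu).2 x.
have bs : bounded_measurable s.
  by apply: bounded_measurableB; apply: bounded_measurable_indic.
have sE x : (hahn_pair mu).1 x /\ s x = 1 \/ (hahn_pair mu).2 x /\ s x = -1.
  rewrite /s !indicE; case: (hahn_pair_cover mu x) => h; [left|right]; split=> //.
    by rewrite mem_set// memNset ?subr0// => /(hahn_pair_disj h).
  by rewrite memNset ?mem_set ?sub0r// => /hahn_pair_disj; exact.
have := pairing_le_split mu (a := 0) (b := 2) mA (bounded_measurableB bf bs).
rewrite (pairingB mu bf bs) pairing_sign => h.
have : `|pairing mu f - tvr mu setT| <= 0 * tvr mu A + 2 * tvr mu (~` A).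
  apply: h => x Ax.
    case: (sE x) => -[hx ->]; first by rewrite fP// subrr normr0.
    by rewrite fN// subrr normr0.
  have := f1 x; case: (sE x) => -[_ ->]; rewrite !ler_norml; lra.
by rewrite ler_norml; lra.
Qed.

End pairing.

(** * Inner regularity of finite Borel measures *)

Section regularity.
Context (R : realType) (S : completeMetricType R).
Implicit Types (A F K U : set S) (m : {finite_measure set (borel S) -> \bar R}).

Lemma open_measurable_borel U : open U -> measurable (U : set (borel S)).
Proof. exact: sub_sigma_algebra. Qed.

Lemma closed_measurable_borel F : closed F -> measurable (F : set (borel S)).
Proof.
move=> cF; rewrite -(setCK F); apply: measurableC.
by apply: open_measurable_borel; exact: closed_openC.
Qed.

Lemma compact_measurable_borel K : compact K -> measurable (K : set (borel S)).
Proof.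
move=> cK; apply: closed_measurable_borel.
exact: (compact_closed (@metric_hausdorff R S) cK).
Qed.

Lemma nonincreasing_small m (F : (set (borel S))^nat) (e : R) : 0 < e ->
  (forall n, measurable (F n)) -> nonincreasing_seq F -> \bigcap_n F n = set0 ->
  exists N, (m (F N) < e%:E)%E.
Proof.
move=> e0 mF niF F0.
have := @nonincreasing_cvg_mu _ _ _ m F _ mF.
rewrite F0 measure0 => /(_ _ measurable0 niF) cF.
have {}cF : (m \o F) n @[n --> \oo] --> (0 : \bar R)%E.
  by apply: cF; rewrite ltey_eq fin_num_measure.
have /cF : nbhs (0 : \bar R)%E [set y | (y < e%:E)%E].
  by apply: open_ereal_lt'; rewrite lte_fin.
by move=> [N _ /(_ N (leqnn N)) h]; exists N.
Qed.

Lemma measure_bigcup_small m (D : (set (borel S))^nat) (e : R) : 0 <= e ->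
  (forall n, measurable (D n)) ->
  (forall n, (m (D n) <= (e / (2 ^ n.+1)%:R)%:E)%E) ->
  (m (\bigcup_n D n) <= e%:E)%E.
Proof.
move=> e0 mD De.
have mU : measurable (\bigcup_n D n) by exact: bigcupT_measurable.
apply: (@le_trans _ _ (\sum_(n <oo) m (D n))%E).
  exact: measure_sigma_subadditive mD mU (@subset_refl _ _).
apply: le_trans (epsilon_trick0 xpredT e0).
by apply: lee_nneseries => // n _ _; exact: De.
Qed.

(** Inner approximation alone is not stable under complement. It is stable under
    countable unions and intersections, so the Borel sets are recovered from the
    sets that have this property together with their complement. *)
Definition closed_inner m (A : set (borel S)) : Prop :=
  measurable A /\ forall e : R, 0 < e -> exists F : set S,
    [/\ closed F, F `<=` A & (m (A `\` F) < e%:E)%E].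

(** The errors are summed geometrically, so that a single bound controls the
    countable union and the countable intersection of the [A n] alike. *)
Lemma closed_inner_seq m (A : (set (borel S))^nat) (e : R) : 0 < e ->
  (forall n, closed_inner m (A n)) ->
  exists F : (set (borel S))^nat,
    [/\ forall n, closed (F n : set S), forall n, F n `<=` A n &
        (m (\bigcup_n (A n `\` F n)) <= e%:E)%E].
Proof.
move=> e0 iA.
have /choice[F hF] : forall n, exists F : set S, [/\ closed F, F `<=` A n &
    (m (A n `\` F) < (e / (2 ^ n.+1)%:R)%:E)%E].
  by move=> n; apply: (iA n).2; rewrite divr_gt0// ltr0n expn_gt0.
exists F; split=> [n|n|]; try by have [] := hF n.
apply: measure_bigcup_small; first exact: ltW.
  move=> n; apply: measurableD; first exact: (iA n).1.
  by apply: closed_measurable_borel; have [] := hF n.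
by move=> n; apply: ltW; have [] := hF n.
Qed.

Lemma closed_inner_bigcap m (A : (set (borel S))^nat) :
  (forall n, closed_inner m (A n)) -> closed_inner m (\bigcap_n A n).
Proof.
move=> iA; have mA n : measurable (A n) by exact: (iA n).1.
split; first exact: bigcapT_measurable.
move=> e e0; have e20 : 0 < e / 2 by rewrite divr_gt0.
have [F [cF FA Fe]] := closed_inner_seq e20 iA.
have mF n : measurable (F n) := closed_measurable_borel (cF n).
exists (\bigcap_n F n); split.
- by apply: closed_bigI => n _; exact: cF.
- by move=> x Fx n _; apply: FA; exact: Fx.
apply: (@le_lt_trans _ _ (e / 2)%:E); last by rewrite lte_fin; lra.
apply: le_trans Fe; apply: le_measure; rewrite ?inE.
- by apply: measurableD; exact: bigcapT_measurable.
- by apply: bigcupT_measurable => n; exact: measurableD.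
move=> x [Ax] /existsNP[n] /not_implyP[_ nFx].
by exists n => //; split=> //; exact: Ax.
Qed.

Lemma closed_inner_bigcup m (A : (set (borel S))^nat) :
  (forall n, closed_inner m (A n)) -> closed_inner m (\bigcup_n A n).
Proof.
move=> iA; have mA n : measurable (A n) by exact: (iA n).1.
split; first exact: bigcupT_measurable.
move=> e e0; have e20 : 0 < e / 2 by rewrite divr_gt0.
have [F [cF FA Fe]] := closed_inner_seq e20 iA.
have mF n : measurable (F n) := closed_measurable_borel (cF n).
have mbF : measurable (\bigcup_n F n) by exact: bigcupT_measurable.
(* A countable union of closed sets need not be closed: by continuity from
   above, finitely many of them already carry all but [e / 2] of the mass. *)
pose G N := \big[setU/set0]_(i < N) F i.
have cG N : closed (G N : set S) by apply: closed_bigsetU => n _; exact: cF.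
have mG N : measurable (G N) := closed_measurable_borel (cG N).
have [|||N GN] := @nonincreasing_small m (fun N => \bigcup_n F n `\` G N) _ e20.
- by move=> n; exact: measurableD.
- move=> a b ab; apply/subsetPset; apply: setDS.
  exact: (@subset_bigsetU _ F _ _ ab).
- rewrite -subset0 => x h; have [[n _ Fx] _] := h 0%N I.
  have [_] := h n.+1 I; apply; rewrite /G big_ord_recr/=; by right.
exists (G N); split=> //.
  by rewrite /G => x; rewrite -bigcup_mkord => -[n _ /FA ?]; exists n.
have mAF : measurable (\bigcup_n (A n `\` F n)).
  by apply: bigcupT_measurable => n; exact: measurableD.
apply: (@le_lt_trans _ _ (m (\bigcup_n (A n `\` F n)) +
    m (\bigcup_n F n `\` G N))%E); last first.
  by rewrite [in ltRHS](splitr e) EFinD lee_ltD// fin_num_measure.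
have mbG : measurable (\bigcup_n F n `\` G N) by exact: measurableD.
apply: (@le_trans _ _ (m (\bigcup_n (A n `\` F n) `|`
    (\bigcup_n F n `\` G N)))); last exact: measureU2.
apply: le_measure; rewrite ?inE.
- by apply: measurableD => //; exact: bigcupT_measurable.
- exact: measurableU.
move=> x [[n _ Ax] nG]; have [Fx|nF] := pselect ((\bigcup_n F n) x).
  by right.
by left; exists n => //; split=> // Fx; apply: nF; exists n.
Qed.

Lemma closed_inner_closed m (F : set S) : closed F -> closed_inner m F.
Proof.
move=> cF; split; first exact: closed_measurable_borel.
by move=> e e0; exists F; split=> //; rewrite setDv measure0 lte_fin.
Qed.

(** An open set is the countable union of the closed sets of those points that
    stay at distance at least [1 / (n + 1)] from its complement. *)
Lemma closed_inner_open m (U : set S) : open U -> closed_inner m U.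
Proof.
move=> oU.
pose F n : set S := [set x | forall z, mdist x z < n.+1%:R^-1 -> U z].
have cF n : closed (F n).
  move=> y cy z yz.
  have r0 : 0 < n.+1%:R^-1 - mdist y z by rewrite subr_gt0.
  have [x [Fx]] := cy _ (nbhsx_ballx y _ r0).
  rewrite ballEmdist/= => yx; apply: Fx.
  by rewrite (le_lt_trans (metric_triangle _ y _))// metric_sym -ltrBrDr.
have -> : U = \bigcup_n F n.
  apply/seteqP; split=> x; last first.
    by move=> [n _]; apply; rewrite mdistxx invr_gt0 ltr0n.
  move=> Ux; have : nbhs x U by exact: open_nbhs_nbhs.
  rewrite -filter_from_ballE => -[e /= e0 eU].
  exists (Num.truncn e^-1) => // z xz; apply: eU; rewrite ballEmdist/=.
  rewrite (lt_le_trans xz)// -[leRHS]invrK lef_pV2 ?posrE ?invr_gt0//.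
  by rewrite ltW// truncnS_gt.
by apply: closed_inner_bigcup => n; exact: closed_inner_closed.
Qed.

Lemma closed_inner_measurable m A : measurable (A : set (borel S)) ->
  closed_inner m A.
Proof.
move=> mA; pose G : set (set (borel S)) :=
  [set A | closed_inner m A /\ closed_inner m (~` A)].
suff : G A by case.
apply: (@smallest_sub _ (sigma_algebra setT) (@open S) G); last exact: mA.
- split.
  + split; rewrite ?setC0; [apply: (closed_inner_closed _ closed0)|].
    exact: (closed_inner_closed _ closedT).
  + by move=> B [iB iCB]; rewrite setTD; split; rewrite ?setCK.
  + move=> B GB; split.
      by apply: closed_inner_bigcup => n; have [] := GB n.
    by rewrite setC_bigcup; apply: closed_inner_bigcap => n; have [] := GB n.
- move=> U oU; split; first exact: closed_inner_open.
  by apply: closed_inner_closed; exact: open_closedC.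
Qed.

Lemma ultra_bigsetU (F : set_system S) (A : (set S)^nat) N : UltraFilter F ->
  F (\big[setU/set0]_(i < N) A i) -> exists n, F (A n).
Proof.
move=> FU; elim: N => [|N IH].
  by rewrite big_ord0 => /filter_ex[].
rewrite big_ord_recr/= => FA.
have [?|FC] := in_ultra_setVsetC (A N) FU; first by exists N.
apply: IH; apply: filterS2 FA FC => x [//|] ANx; by move/(_ ANx).
Qed.

Lemma closed_mdist_ball (c : S) (r : R) : closed [set x : S | mdist c x <= r].
Proof.
move=> y cy; apply/ler_addgt0Pr => e e0.
have [x [/= cx]] := cy _ (nbhsx_ballx y _ e0); rewrite ballEmdist/= => yx.
rewrite (le_trans (metric_triangle _ x _))// lerD//.
by rewrite metric_sym ltW.
Qed.

(** Completeness enters here: an ultrafilter on a set covered, for every [k], by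
    finitely many balls of radius [1 / (k + 1)] is Cauchy. *)
Lemma totally_bounded_compact (d : S^nat) (N : nat^nat) :
  compact (\bigcap_k \big[setU/set0]_(i < N k)
    [set x : S | mdist (d i) x <= k.+1%:R^-1]).
Proof.
set C := (X in compact X).
have cC : closed C.
  by apply: closed_bigI => k _; apply: closed_bigsetU => n _; exact: closed_mdist_ball.
rewrite compact_ultra => F FU FC.
have : cvg F.
  apply: cauchy_cvg; apply: cauchy_exP => e e0.
  pose k := Num.truncn e^-1.
  have : F (\big[setU/set0]_(i < N k) [set x | mdist (d i) x <= k.+1%:R^-1]).
    by apply: filterS FC => x; apply.
  move=> /(@ultra_bigsetU F (fun i => [set x | mdist (d i) x <= k.+1%:R^-1]) _ FU).
  move=> [n Fn]; exists (d n).
  apply: filterS Fn => x/= dx; rewrite ballEmdist/=.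
  rewrite (le_lt_trans dx)// -[ltRHS]invrK ltf_pV2 ?posrE ?invr_gt0//.
  by rewrite truncnS_gt.
move=> /cvg_ex[p Fp]; exists p; split=> //.
by apply: cC => B /Fp FB; exact: filter_ex (filterI FC FB).
Qed.

Lemma dense_seq : separable S -> exists d : S^nat, forall (x : S) (e : R), 0 < e ->
  exists n, mdist (d n) x < e.
Proof.
move=> [D cD dD].
have /pfcard_geP[D0|[d]] := cD.
  have [x []] := dD setT (ex_intro _ point I) openT.
  by rewrite D0.
exists d => x e e0.
have [oB Bx] := open_nbhs_ball x (PosNum e0).
have [y [/interior_subset/= xy Dy]] := dD _ (ex_intro _ x Bx) oB.
have [n _ dn] := surj (f := d) Dy.
by exists n; rewrite dn metric_sym; move: xy; rewrite ballEmdist.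
Qed.

(** Ulam's theorem: at each scale [1 / (k + 1)] finitely many balls around a
    dense sequence carry all the mass up to a geometrically small error, and the
    intersection over [k] is totally bounded and closed. *)
Lemma measure_tight m (e : R) : separable S -> 0 < e ->
  exists2 K : set S, compact K & (m (~` K) < e%:E)%E.
Proof.
move=> /dense_seq[d dP] e0; have e20 : 0 < e / 2 by rewrite divr_gt0.
pose B k i : set S := [set x : S | mdist (d i) x <= k.+1%:R^-1].
pose G k n := \big[setU/set0]_(i < n) B k i.
have cG k n : closed (G k n).
  by apply: closed_bigsetU => i _; exact: closed_mdist_ball.
have mCG k n : measurable (~` G k n : set (borel S)).
  by apply: measurableC; exact: (closed_measurable_borel (cG k n)).
have /choice[N hN] : forall k, exists n,
    (m (~` G k n) < (e / 2 / (2 ^ k.+1)%:R)%:E)%E.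
  move=> k; apply: (@nonincreasing_small m (fun n => ~` G k n)) => //.
  - by rewrite divr_gt0// ltr0n expn_gt0.
  - move=> a b ab; apply/subsetPset; apply: subsetC.
    exact: (@subset_bigsetU _ (fun i => B k i) _ _ ab).
  - rewrite -subset0 => x h.
    have k0 : 0 < k.+1%:R^-1 :> R by rewrite invr_gt0.
    have [n dn] := dP x _ k0.
    have := h n.+1 I; apply; rewrite /G big_ord_recr/=; right.
    by rewrite /B/= ltW.
exists (\bigcap_k G k (N k)); first exact: (@totally_bounded_compact d N).
rewrite setC_bigcap; apply: (@le_lt_trans _ _ (e / 2)%:E).
  apply: measure_bigcup_small => //; first exact: ltW.
  by move=> k; apply/ltW/hN.
by rewrite lte_fin; lra.
Qed.

Lemma compact_inner m A (e : R) : separable S ->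
  measurable (A : set (borel S)) -> 0 < e ->
  exists K : set S, [/\ compact K, K `<=` A & (m (A `\` K) < e%:E)%E].
Proof.
move=> sepS mA e0; have e20 : 0 < e / 2 by rewrite divr_gt0.
have [F [cF FA mF]] := (closed_inner_measurable m mA).2 _ e20.
have [K cK mK] := measure_tight m sepS e20.
exists (K `&` F); split; first exact: compact_closedI.
  by apply: subset_trans FA; exact: subIsetr.
have mF' := closed_measurable_borel cF.
have mK' := compact_measurable_borel cK.
have mAF : measurable (A `\` F : set (borel S)) by exact: measurableD.
have mCK : measurable (~` K : set (borel S)) by exact: measurableC.
apply: (@le_lt_trans _ _ (m (A `\` F) + m (~` K))%E); last first.
  by rewrite [in ltRHS](splitr e) EFinD lteD.
apply: (@le_trans _ _ (m ((A `\` F) `|` ~` K))); last exact: measureU2.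
apply: le_measure; rewrite ?inE.
- by apply: measurableD => //; exact: measurableI.
- exact: measurableU.
by move=> x [Ax] /not_andP[?|?]; [right|left].
Qed.

End regularity.

(** * Distance to a set and bounded Lipschitz functions *)

Section sup_nonneg.
Context (R : realType).
Implicit Types (E : set R) (B : R).

(** The supremum of the empty set, and of an unbounded one, is 0. The set that
    defines the Lipschitz constant is empty on a one-point space, so bounds on
    it cannot assume nonemptiness; a sign condition replaces it. *)
Lemma sup_nonneg E : (forall r, E r -> 0 <= r) -> 0 <= sup E.
Proof.
move=> E0; have [sE|nE] := pselect (has_sup E); last by rewrite sup_out.
have [[r Er] ubE] := sE.
by rewrite (le_trans (E0 _ Er))// ub_le_sup.
Qed.

Lemma sup_le_nonneg E B : 0 <= B -> (forall r, E r -> r <= B) -> sup E <= B.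
Proof.
move=> B0 EB; have [/set0P/ge_sup|/negPn/eqP->] := boolP (E != set0).
  exact.
by rewrite sup0.
Qed.

End sup_nonneg.

Section metric.
Context (R : realType) (S : metricType R).
Implicit Types (f g : S -> R) (A C : set S) (lam : R) (x y : S).

Lemma dist_set_le A x a : A a -> dist_set A x <= mdist x a.
Proof.
move=> Aa; apply: ge_inf; last by exists a.
by exists 0 => _ [b _ <-]; exact: mdist_ge0.
Qed.

Lemma dist_set_ge A x (c : R) : A !=set0 -> (forall a, A a -> c <= mdist x a) ->
  c <= dist_set A x.
Proof.
move=> [a Aa] cA; apply: lb_le_inf; first by exists (mdist x a), a.
by move=> _ [b Ab <-]; exact: cA.
Qed.

Lemma dist_set_ge0 A x : A !=set0 -> 0 <= dist_set A x.
Proof. by move=> A0; apply: dist_set_ge => // a _; exact: mdist_ge0. Qed.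

Lemma dist_set_lt A x (c : R) : A !=set0 -> dist_set A x < c ->
  exists2 a, A a & mdist x a < c.
Proof.
move=> A0 xc; have [||_ [a Aa <-] ac] := @inf_lt _ [set mdist x a | a in A] c; last by exists a.
  by case: A0 => a Aa; exists (mdist x a), a.
exact: xc.
Qed.

Lemma dist_set_mem A x : A x -> dist_set A x = 0.
Proof.
move=> Ax; apply/eqP; rewrite eq_le dist_set_ge0 ?andbT; last by exists x.
by rewrite (le_trans (dist_set_le x Ax))// mdistxx.
Qed.

Lemma dist_set_triangle A x y : A !=set0 ->
  dist_set A x <= mdist x y + dist_set A y.
Proof.
move=> A0; rewrite -lerBlDl; apply: dist_set_ge => // a Aa.
rewrite lerBlDl (le_trans (dist_set_le x Aa))//; exact: metric_triangle.
Qed.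

Lemma dist_set_lip A x y : A !=set0 ->
  `|dist_set A x - dist_set A y| <= mdist x y.
Proof.
move=> A0; have := dist_set_triangle x y A0; have := dist_set_triangle y x A0.
rewrite (metric_sym y x) ler_norml; lra.
Qed.

Lemma closed_thickening A lam : A !=set0 -> closed (thickening A lam).
Proof.
move=> A0 y cy; rewrite /thickening/=; apply/ler_addgt0Pr => e e0.
have [x [+]] := cy _ (nbhsx_ballx y _ e0); rewrite /thickening ballEmdist/= => xA yx.
have := dist_set_triangle y x A0; lra.
Qed.

Lemma subset_thickening A C lam : A !=set0 -> A `<=` C ->
  thickening A lam `<=` thickening C lam.
Proof.
move=> A0 AC x; rewrite /thickening/=; apply: le_trans.
by apply: dist_set_ge => // a /AC; exact: dist_set_le.
Qed.

Lemma hat_ge0 lam C x : 0 <= hat lam C x.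
Proof. by rewrite /hat le_max lexx orbT. Qed.

Lemma hat_le1 lam C x : 0 <= lam -> C !=set0 -> hat lam C x <= 1.
Proof.
move=> l0 C0; rewrite /hat ge_max ler01 andbT lerBlDr lerDl.
by rewrite mulr_ge0 ?invr_ge0// dist_set_ge0.
Qed.

Lemma hat1 lam C x : C x -> hat lam C x = 1.
Proof. by move=> Cx; rewrite /hat dist_set_mem// mulr0 subr0 max_l. Qed.

Lemma hat0 lam C x : 0 < lam -> lam <= dist_set C x -> hat lam C x = 0.
Proof. by move=> l0 xl; rewrite /hat max_r// subr_le0 mulrC ler_pdivlMr// mul1r. Qed.

Lemma ler_dist_max (a b c e : R) :
  `|Num.max a b - Num.max c e| <= Num.max `|a - c| `|b - e|.
Proof.
have := ler_norm (a - c); have := ler_norm (c - a).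
have := ler_norm (b - e); have := ler_norm (e - b).
rewrite (distrC e b) (distrC c a) => h1 h2 h3 h4.
rewrite le_max !ler_norml.
by case: (leP a b); case: (leP c e) => h5 h6; apply/orP; lra.
Qed.

Lemma BL_max f g : BL f -> BL g -> BL (fun x => Num.max (f x) (g x)).
Proof.
move=> [[B fB] [L fL]] [[B' gB] [L' gL]]; split.
  exists (B + B') => x; have := fB x; have := gB x.
  have := normr_ge0 (f x); have := normr_ge0 (g x).
  by case: (leP (f x) (g x)); lra.
exists (Num.max L L') => x y; rewrite (le_trans (ler_dist_max _ _ _ _))//.
rewrite ge_max; apply/andP; split.
  by rewrite (le_trans (fL x y))// ler_wpM2r ?mdist_ge0// le_max lexx.
by rewrite (le_trans (gL x y))// ler_wpM2r ?mdist_ge0// le_max lexx orbT.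
Qed.

Lemma BL_cst (c : R) : BL (fun _ : S => c).
Proof.
split; first by exists `|c|.
by exists 0 => x y; rewrite subrr normr0 mul0r.
Qed.

Lemma BLB f g : BL f -> BL g -> BL (fun x => f x - g x).
Proof.
move=> [[B fB] [L fL]] [[B' gB] [L' gL]]; split.
  by exists (B + B') => x; rewrite (le_trans (ler_normB _ _))// lerD.
exists (L + L') => x y; rewrite mulrDl.
rewrite (_ : _ - _ = (f x - f y) - (g x - g y)); last lra.
by rewrite (le_trans (ler_normB _ _))// lerD.
Qed.

Lemma BLZ (c : R) f : BL f -> BL (fun x => c * f x).
Proof.
move=> [[B fB] [L fL]]; split.
  by exists (`|c| * B) => x; rewrite normrM ler_wpM2l.
by exists (`|c| * L) => x y; rewrite -mulrBr normrM -mulrA ler_wpM2l.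
Qed.

Lemma BL_hat lam C : 0 < lam -> C !=set0 -> BL (hat lam C).
Proof.
move=> l0 C0; split.
  by exists 1 => x; rewrite ger0_norm ?hat_ge0// hat_le1// ltW.
exists lam^-1 => x y; rewrite (le_trans (ler_dist_max _ _ _ _))//.
rewrite subrr normr0 max_l ?normr_ge0//.
rewrite (_ : _ - _ = lam^-1 * (dist_set C y - dist_set C x)); last lra.
rewrite normrM gtr0_norm ?invr_gt0// ler_wpM2l ?invr_ge0 ?(ltW l0)//.
by rewrite distrC dist_set_lip.
Qed.

Lemma sup_norm_ge f x : BL f -> `|f x| <= sup_norm f.
Proof.
move=> [[B fB] _]; apply: ub_le_sup; last by exists x.
by exists B => _ [y _ <-].
Qed.

Lemma lip_const_ge f x y : BL f -> `|f x - f y| <= lip_const f * mdist x y.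
Proof.
move=> [_ [L fL]]; have [->|xy] := eqVneq x y.
  by rewrite subrr normr0 mdistxx mulr0.
have d0 : 0 < mdist x y by rewrite mdist_gt0.
rewrite -ler_pdivrMr//; apply: ub_le_sup.
  exists L => _ [[a b] /= ab <-]; rewrite ler_pdivrMr// mdist_gt0.
  exact/eqP.
by exists (x, y) => //=; exact/eqP.
Qed.

Lemma sup_norm_ge0 f : 0 <= sup_norm f.
Proof. by apply: sup_nonneg => _ [x _ <-]. Qed.

Lemma lip_const_ge0 f : 0 <= lip_const f.
Proof. by apply: sup_nonneg => _ [p _ <-]; rewrite divr_ge0// mdist_ge0. Qed.

Lemma BL_norm_le1 f : BL f -> BL_norm f <= 1 ->
  (forall x, `|f x| <= 1) /\ (forall x y, `|f x - f y| <= mdist x y).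
Proof.
move=> bf f1; have s0 := sup_norm_ge0 f; have l0 := lip_const_ge0 f.
split=> [x|x y].
  by rewrite (le_trans (sup_norm_ge x bf))//; move: f1; rewrite /BL_norm; lra.
rewrite (le_trans (lip_const_ge x y bf))// ler_piMl ?mdist_ge0//.
by move: f1; rewrite /BL_norm; lra.
Qed.

Lemma BL_norm_le f (B L : R) : 0 <= B -> 0 <= L -> (forall x, `|f x| <= B) ->
  (forall x y, `|f x - f y| <= L * mdist x y) -> BL_norm f <= B + L.
Proof.
move=> B0 L0 fB fL; apply: lerD.
  by apply: sup_le_nonneg => // _ [x _ <-].
by apply: sup_le_nonneg => // _ [[x y] /= xy <-]; rewrite ler_pdivrMr ?mdist_gt0//; exact/eqP.
Qed.

End metric.

(** * Concentration on a thickened compact set *)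

Section lipschitz.
Context (R : realType) (S : metricType R).

Lemma lipschitz_continuous (f : S -> R) (L : R) :
  (forall x y, `|f x - f y| <= L * mdist x y) -> continuous f.
Proof.
move=> fL x; apply/cvgrPdist_lt => e e0.
have L1 : 0 < `|L| + 1 by rewrite ltr_wpDl.
apply: filterS (nbhsx_ballx x _ (divr_gt0 e0 L1)) => y.
rewrite ballEmdist/= ltr_pdivlMr// => xy.
rewrite (le_lt_trans (fL x y))// (le_lt_trans _ xy)// mulrC ler_wpM2l ?mdist_ge0//.
by rewrite (le_trans (ler_norm L))// lerDl.
Qed.

Lemma compact_disjoint_separated (K C : set S) : compact K -> closed C ->
  K !=set0 -> C !=set0 -> (forall x, K x -> C x -> False) ->
  exists2 r : R, 0 < r & forall x, K x -> r <= dist_set C x.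
Proof.
move=> cK cC K0 C0 KC.
have ct : continuous (dist_set C).
  apply: (@lipschitz_continuous _ 1) => x y.
  by rewrite mul1r; exact: dist_set_lip.
have [c] := compact_EVT_min K0 cK (continuous_subspaceT ct).
rewrite inE => Kc cmin; exists (dist_set C c); last first.
  by move=> x Kx; apply: cmin; rewrite inE.
rewrite lt_neqAle dist_set_ge0// andbT eq_sym; apply/negP => /eqP c0.
apply: (KC c) => //; apply: cC => B; rewrite -filter_from_ballE => -[e/= e0 eB].
have [a Ca ca] : exists2 a, C a & mdist c a < e.
  by apply: dist_set_lt => //; rewrite c0.
by exists a; split=> //; apply: eB; rewrite ballEmdist.
Qed.

End lipschitz.

(** Makes regularity of finite measures applicable to the total variation. *)
HB.instance Definition _ d (T : measurableType d) (R : realType)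
    (mu : {charge set T -> \bar R}) :=
  Measure_isFinite.Build _ _ _ (charge_variation (hahn_pairP mu))
    (@tv_measure_fin _ _ _ mu).

Section concentration.
Context (R : realType) (S : completeMetricType R).
Implicit Types (mu nu : signed_measure S) (f : S -> R) (K : set S).

Lemma BL_bounded_measurable f : BL f -> bounded_measurable (f : borel S -> R).
Proof.
move=> [fB [L fL]]; split=> //.
have /continuousP cf := lipschitz_continuous fL.
apply: (measurability _ (RGenOpens.measurableE R)).
move=> _ [_ [a [b ->] <-]]; rewrite setTI.
by apply: open_measurable_borel; apply/cf/interval_open.
Qed.

(** Inner regularity is applied inside each Hahn set, so that the sign of [mu] is
    constant on each of the two compacts. *)
Lemma hahn_tight mu (e : R) : separable S -> 0 < e ->
  exists K1 K2, [/\ compact K1, compact K2,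
    K1 `<=` (hahn_pair mu).1, K2 `<=` (hahn_pair mu).2 &
    tvr mu (~` (K1 `|` K2)) < e].
Proof.
move=> sepS e0; have e20 : 0 < e / 2 by rewrite divr_gt0.
have [mP mN] := hahn_pair_measurable mu.
pose v : {finite_measure set (borel S) -> \bar R} :=
  charge_variation (hahn_pairP mu).
have [K1 [cK1 K1P v1]] := compact_inner v sepS mP e20.
have [K2 [cK2 K2N v2]] := compact_inner v sepS mN e20.
exists K1, K2; split=> //.
have mK1 := compact_measurable_borel cK1.
have mK2 := compact_measurable_borel cK2.
have mPK : measurable ((hahn_pair mu).1 `\` K1) by exact: measurableD.
have mNK : measurable ((hahn_pair mu).2 `\` K2) by exact: measurableD.
have mK : measurable (~` (K1 `|` K2) : set (borel S)).
  by apply: measurableC; exact: measurableU.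
rewrite -lte_fin tvrK//.
apply: (@le_lt_trans _ _
  (v ((hahn_pair mu).1 `\` K1) + v ((hahn_pair mu).2 `\` K2))%E); last first.
  by rewrite [in ltRHS](splitr e) EFinD lteD.
apply: (@le_trans _ _
    (v ((hahn_pair mu).1 `\` K1 `|` (hahn_pair mu).2 `\` K2))); last first.
  exact: measureU2.
apply: (@le_measure _ _ _ v); rewrite ?inE//; first exact: measurableU.
by move=> x /not_orP[n1 n2]; case: (hahn_pair_cover mu x); [left|right].
Qed.

(** For small [lam] the difference of the two hats is the sign of [mu] on the
    compacts: the hats do not interfere once [lam] is below the distance between
    them. If one of the two Hahn compacts is empty it is replaced by the other
    one, with a zero coefficient, so that both sets are nonempty. *)
Lemma hat_test mu (e : R) : separable S -> 0 < e -> e <= tvr mu setT ->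
  exists K1 K2 (a1 a2 lam0 : R),
  [/\ (compact K1 /\ K1 !=set0) /\ (compact K2 /\ K2 !=set0),
      (0 <= a1 <= 1) /\ (0 <= a2 <= 1),
      tvr mu (~` (K1 `|` K2)) < e, 0 < lam0 &
      forall lam, 0 < lam <= lam0 ->
        tvr mu setT - 2 * tvr mu (~` (K1 `|` K2)) <=
        pairing mu (fun x => a1 * hat lam K1 x - a2 * hat lam K2 x)].
Proof.
move=> sepS e0 eT.
have [K1 [K2 [cK1 cK2 K1P K2N tK]]] := hahn_tight mu sepS e0.
have mK : measurable (K1 `|` K2 : set (borel S)).
  by apply: measurableU; exact: compact_measurable_borel.
have hat_bound lam K x : 0 < lam -> K !=set0 -> 0 <= hat lam K x <= 1.
  by move=> l0 K0; rewrite hat_ge0 hat_le1// ltW.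
have bm (a1 a2 lam : R) K K' : 0 < lam -> K !=set0 -> K' !=set0 ->
    bounded_measurable
      ((fun x => a1 * hat lam K x - a2 * hat lam K' x) : borel S -> R).
  move=> l0 K0 K'0; apply: BL_bounded_measurable.
  by apply: BLB; apply: BLZ; exact: BL_hat.
have [/set0P K10|/negPn/eqP K10] := boolP (K1 != set0); last first.
  have [/set0P K20|/negPn/eqP K20] := boolP (K2 != set0); last first.
    by move: tK; rewrite K10 K20 setU0 setC0 ltNge eT.
  exists K2, K2, 0, 1, 1; rewrite setUid; rewrite K10 set0U in mK tK.
  split=> //; first by split; rewrite ?lexx ?ler01.
  move=> lam /andP[l0 _]; apply: pairing_ge_sign => //.
  - exact: bm.
  - by move=> x; have := hat_bound _ _ x l0 K20; rewrite ler_norml; lra.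
  - by move=> x /K2N xN xP; case: (hahn_pair_disj xP xN).
  - by move=> x K2x _; rewrite hat1//; lra.
have [/set0P K20|/negPn/eqP K20] := boolP (K2 != set0); last first.
  exists K1, K1, 1, 0, 1; rewrite setUid; rewrite K20 setU0 in mK tK.
  split=> //; first by split; rewrite ?lexx ?ler01.
  move=> lam /andP[l0 _]; apply: pairing_ge_sign => //.
  - exact: bm.
  - by move=> x; have := hat_bound _ _ x l0 K10; rewrite ler_norml; lra.
  - by move=> x K1x _; rewrite hat1//; lra.
  - by move=> x /K1P xP xN; case: (hahn_pair_disj xP xN).
have disj x : K1 x -> K2 x -> False.
  by move=> /K1P xP /K2N xN; exact: (hahn_pair_disj xP xN).
have cl K : compact K -> closed K := compact_closed (@metric_hausdorff R S).
have [r1 r10 hr1] := compact_disjoint_separated cK1 (cl _ cK2) K10 K20 disj.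
have [r2 r20 hr2] := compact_disjoint_separated cK2 (cl _ cK1) K20 K10
  (fun x h2 h1 => disj x h1 h2).
exists K1, K2, 1, 1, (Num.min r1 r2); split=> //.
- by split; rewrite ?lexx ?ler01.
- by rewrite lt_min r10.
move=> lam; rewrite le_min => /andP[l0 /andP[l1 l2]].
apply: pairing_ge_sign => //; first exact: bm.
- move=> x; have := hat_bound _ _ x l0 K10; have := hat_bound _ _ x l0 K20.
  by rewrite ler_norml; lra.
- move=> x [K1x _|/K2N xN xP]; last by case: (hahn_pair_disj xP xN).
  by rewrite hat1// hat0 ?(le_trans l1 (hr1 _ K1x))//; lra.
- move=> x [/K1P xP xN|K2x _]; first by case: (hahn_pair_disj xP xN).
  by rewrite (hat1 _ K2x) hat0 ?(le_trans l2 (hr2 _ K2x))//; lra.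
Qed.

(** The test function [g] built from the hats is bounded by 1, vanishes off the
    thickening and pairs with [mu] to almost [rho]. If [nu] pairs with the hats
    almost as [mu] does, then [pairing nu g] is almost [rho] too, whereas it is
    at most the mass of [nu] on the thickening; as [nu] has total mass exactly
    [rho], little is left outside. *)
Lemma concentration (rho : R) mu (eps : R) : separable S -> 0 < rho ->
  tv_sphere S rho mu -> 0 < eps ->
  exists n : nat, exists K : 'I_n -> set S,
   [/\ (0 < n)%N,
       forall i, K i !=set0 /\ compact (K i),
       (tv_measure mu (~` \bigcup_i K i) < eps%:E)%E &
       exists lam0 : R, 0 < lam0 <= eps /\
         forall lam : R, 0 < lam <= lam0 ->
         exists delta : 'I_n -> R, (forall i, 0 < delta i) /\
           forall nu : signed_measure S, tv_sphere S rho nu ->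
           (forall i, `|pairing (csub mu nu) (hat lam (K i))| < delta i) ->
           (tv_measure nu (~` thickening (\bigcup_i K i) lam) < eps%:E)%E].
Proof.
move=> sepS rho0 muM eps0.
have tvM nu : tv_sphere S rho nu -> tvr nu setT = rho.
  by rewrite /tv_sphere/tvr/= => ->.
(* The mass of [nu] outside is at most twice the mass of [mu] outside the
   compacts plus the two errors in the hats: four times [eps / 5]. *)
pose e := Num.min (eps / 5) rho.
have e0 : 0 < e by rewrite lt_min rho0 divr_gt0.
have e_eps : e <= eps / 5 by rewrite ge_min lexx.
have e_rho : e <= tvr mu setT by rewrite tvM// ge_min lexx orbT.
have [K1 [K2 [a1 [a2 [lam0 [[[cK1 K10] [cK2 K20]] [a1b a2b] tK l00 test]]]]]] :=
  hat_test sepS e0 e_rho.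
pose K (i : 'I_2) := if i == ord0 then K1 else K2.
have KE : \bigcup_i K i = K1 `|` K2.
  apply/seteqP; split=> [x [i _]|x [K1x|K2x]].
  - by rewrite /K; case: (i == ord0); [left|right].
  - by exists ord0.
  - by exists ord_max.
have mK : measurable (K1 `|` K2 : set (borel S)).
  by apply: measurableU; exact: compact_measurable_borel.
exists 2, K; split=> //.
- by move=> i; rewrite /K; case: (i == ord0).
- rewrite KE -tvrK; last exact: measurableC.
  by rewrite lte_fin; lra.
exists (Num.min lam0 eps); split; first by rewrite lt_min l00 eps0 ge_min lexx orbT.
move=> lam; rewrite le_min => /andP[l0 /andP[ll0 _]].
exists (fun=> eps / 5); split; first by move=> _; rewrite divr_gt0.
move=> nu nuM hnu; rewrite KE.
have K0 : (K1 `|` K2) !=set0 by case: K10 => x K1x; exists x; left.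
have mT : measurable (thickening (K1 `|` K2) lam : set (borel S)).
  by apply: closed_measurable_borel; exact: closed_thickening.
have bh k : k !=set0 -> bounded_measurable (hat lam k : borel S -> R).
  by move=> k0; apply: BL_bounded_measurable; exact: BL_hat.
have bZ (a : R) k : k !=set0 ->
    bounded_measurable ((fun x => a * hat lam k x) : borel S -> R).
  by move=> k0; apply: bounded_measurableZ; exact: bh.
have h1 := hnu ord0; have h2 := hnu ord_max.
rewrite /K/= (pairing_csub mu nu (bh _ K10)) in h1.
rewrite /K/= (pairing_csub mu nu (bh _ K20)) in h2.
have := test lam; rewrite l0 ll0 => /(_ isT).
rewrite (pairingB _ (bZ a1 _ K10) (bZ a2 _ K20)).
rewrite (pairingZ _ a1 (bh _ K10)) (pairingZ _ a2 (bh _ K20)) tvM// => hmu.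
pose g x := a1 * hat lam K1 x - a2 * hat lam K2 x.
have gnu : `|pairing nu g| <= 1 * tvr nu (thickening (K1 `|` K2) lam) +
    0 * tvr nu (~` thickening (K1 `|` K2) lam).
  apply: pairing_le_split => //.
  - exact: bounded_measurableB (bZ a1 _ K10) (bZ a2 _ K20).
  - move=> x _; rewrite /g ler_norml.
    have := hat_ge0 lam K1 x; have := hat_le1 x (ltW l0) K10.
    have := hat_ge0 lam K2 x; have := hat_le1 x (ltW l0) K20.
    nra.
  move=> x /negP; rewrite -ltNge => xK.
  have far k : k `<=` K1 `|` K2 -> k !=set0 -> lam <= dist_set k x.
    move=> kK k0; rewrite leNgt; apply/negP => xk.
    by have := subset_thickening k0 kK (ltW xk); rewrite /thickening/= leNgt xK.
  rewrite /g !hat0//; [|by apply: far => // y; right|by apply: far => // y; left].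
  by rewrite !mulr0 subrr normr0.
move: gnu; rewrite /g (pairingB _ (bZ a1 _ K10) (bZ a2 _ K20)).
rewrite (pairingZ _ a1 (bh _ K10)) (pairingZ _ a2 (bh _ K20)).
have := tvrC nu mT; rewrite tvM// => tvnu.
rewrite -tvrK ?lte_fin; last exact: measurableC.
set p1 := pairing mu _ in h1 hmu; set p2 := pairing mu _ in h2 hmu.
set q1 := pairing nu _ in h1 *; set q2 := pairing nu _ in h2 *.
move=> gnu.
have a1h : a1 * (p1 - q1) <= eps / 5.
  by move: h1 a1b; rewrite ltr_norml; nra.
have a2h : - (eps / 5) <= a2 * (p2 - q2).
  by move: h2 a2b; rewrite ltr_norml; nra.
by move: gnu; rewrite ler_norml; lra.
Qed.

End concentration.

(** * Finite interpolation of bounded Lipschitz functions *)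

Section partition.
Context (R : realType) (S : metricType R).
Context (lam : R) (lam_gt0 : 0 < lam).
Implicit Types (f : S -> R) (c x : S) (s : seq S).

(** The radius is [3 * lam] because a point of the thickening of radius [lam] of a
    set is within [2 * lam] of that set, hence within [3 * lam] of a
    [lam]-net of it. *)
Definition plateau c : set S := [set x | mdist c x <= 3 * lam].

Lemma plateau_nonempty c : plateau c !=set0.
Proof. by exists c; rewrite /plateau/= mdistxx mulr_ge0// ltW. Qed.

(** The running maximum of bumps around the centres. Its successive increments
    form a Lipschitz partition of unity wherever the envelope equals 1, and
    unlike normalized bumps they involve no division. *)
Fixpoint envelope s x : R :=
  if s is c :: s' then
    Num.max (hat lam (plateau c) x) (envelope s' x)
  else 0.

Fixpoint interpolant f s x : R :=
  if s is c :: s' then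
    f c * (envelope s x - envelope s' x) + interpolant f s' x
  else 0.

Lemma BL_envelope s : BL (envelope s).
Proof.
elim: s => [|c s IH]; first exact: BL_cst.
by apply: BL_max => //; exact: (BL_hat lam_gt0 (plateau_nonempty c)).
Qed.

Lemma envelope_ge0 s x : 0 <= envelope s x.
Proof. by elim: s => //= c s IH; rewrite le_max hat_ge0. Qed.

Lemma envelope_le1 s x : envelope s x <= 1.
Proof.
elim: s => [|c s IH]; first exact: ler01.
by rewrite /= ge_max IH andbT (hat_le1 x (ltW lam_gt0) (plateau_nonempty c)).
Qed.

Lemma envelope1 s c x : c \in s -> mdist c x <= 3 * lam -> envelope s x = 1.
Proof.
elim: s => //= a s IH; rewrite inE => /predU1P[->|cs] cx.
  by rewrite hat1// max_l// envelope_le1.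
by rewrite (IH cs cx) max_r// (hat_le1 x (ltW lam_gt0) (plateau_nonempty a)).
Qed.

Lemma BL_interpolant f s : BL (interpolant f s).
Proof.
elim: s => [|c s IH]; first exact: BL_cst.
have -> : interpolant f (c :: s) = (fun x =>
    f c * (envelope (c :: s) x - envelope s x) - (-1) * interpolant f s x).
  by apply/funext => x /=; lra.
apply: BLB; apply: BLZ => //.
by apply: BLB; exact: BL_envelope.
Qed.

Lemma interpolant_le f s x : (forall y, `|f y| <= 1) ->
  `|interpolant f s x| <= envelope s x.
Proof.
move=> f1; elim: s => [|c s IH]; first by rewrite normr0.
have d0 : 0 <= envelope (c :: s) x - envelope s x.
  by rewrite subr_ge0 /= le_max lexx orbT.
rewrite [interpolant _ _ _]/= -/(envelope (c :: s) x).
move: d0; set d := _ - _ => d0.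
have -> : envelope (c :: s) x = d + envelope s x by rewrite /d subrK.
rewrite (le_trans (ler_normD _ _))// lerD// normrM (ger0_norm d0).
by rewrite ler_piMl.
Qed.

(** The increment of the envelope at the centre [c] is nonzero only within
    distance [4 * lam] of [c], where replacing [f x] by [f c] costs at most
    [4 * lam] times that increment; the increments add up to the envelope. *)
Lemma interpolant_error f s x : (forall y z, `|f y - f z| <= mdist y z) ->
  `|f x * envelope s x - interpolant f s x| <= 4 * lam * envelope s x.
Proof.
move=> fL; elim: s => [|c s IH]; first by rewrite /= !mulr0 subr0 normr0.
have d0 : 0 <= envelope (c :: s) x - envelope s x.
  by rewrite subr_ge0 /= le_max lexx orbT.
rewrite [interpolant _ _ _]/= -/(envelope (c :: s) x).
have near_c : envelope (c :: s) x - envelope s x != 0 ->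
    `|f x - f c| <= 4 * lam.
  move=> dn0; rewrite (le_trans (fL _ _))// leNgt; apply/negP => far.
  case/negP: dn0; rewrite /= hat0 ?max_r ?subrr ?envelope_ge0//.
  apply: (dist_set_ge (plateau_nonempty c)) => a; rewrite /plateau/= => ca.
  have := metric_triangle x a c; rewrite (metric_sym a c); lra.
move: d0 near_c; set d := _ - _ => d0 near_c.
have -> : envelope (c :: s) x = d + envelope s x by rewrite /d subrK.
have -> : f x * (d + envelope s x) - (f c * d + interpolant f s x) =
    (f x - f c) * d + (f x * envelope s x - interpolant f s x) by lra.
rewrite [leRHS]mulrDr (le_trans (ler_normD _ _))// lerD// normrM (ger0_norm d0).
have [->|dn0] := eqVneq d 0; first by rewrite !mulr0.
by rewrite ler_wpM2r// near_c.
Qed.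

End partition.

(** * Weak and dual norm topologies on a sphere *)

Section topologies.
Context (R : realType) (S : completeMetricType R).
Implicit Types (mu nu sigma : signed_measure S) (f : S -> R) (K : set S).

Lemma compact_net K (lam : R) : compact K -> 0 < lam ->
  exists s : seq S, forall x, K x -> exists2 c, c \in s & mdist c x < lam.
Proof.
rewrite compact_cover => cK l0.
have [|x Kx|D _ KD] := cK S K (fun c => (ball c lam)°).
- by move=> c _; exact: open_interior.
- by exists x => //; exact: nbhsx_ballx.
exists (finmap.enum_fset D) => x /KD[c /= cD /interior_subset].
rewrite ballEmdist/= => cx; by exists c.
Qed.

Lemma pairing_le_dual sigma f : BL f -> BL_norm f <= 1 ->
  `|pairing sigma f| <= BL_dual_norm sigma.
Proof.
move=> bf f1; apply: ub_le_sup; last by exists f.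
exists (1 * tvr sigma setT) => _ [g [bg g1] <-].
apply: pairing_le; first exact: BL_bounded_measurable.
by have [] := BL_norm_le1 bg g1.
Qed.

Lemma BL_dual_norm_le sigma (c : R) : 0 <= c ->
  (forall f, BL f -> BL_norm f <= 1 -> `|pairing sigma f| <= c) ->
  BL_dual_norm sigma <= c.
Proof.
by move=> c0 h; apply: sup_le_nonneg => // _ [f [bf f1] <-]; exact: h.
Qed.

Lemma near_weak mu f (delta : R) : BL f -> 0 < delta ->
  \forall nu \near (mu : weak_measures S), `|pairing (csub mu nu) f| < delta.
Proof.
move=> bf d0.
pose i : set_type (@BL R S) := exist _ f (mem_set bf).
pose F : set_system (signed_measure S) := nbhs (mu : weak_measures S).
have FF : Filter F by exact: (@nbhs_filter (weak_measures S) mu).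
have /(cvg_sup _ _ FF)/(_ i) : F --> (mu : weak_measures S) by exact: cvg_refl.
pose Wi := initial_topology (fun nu : signed_measure S => pairing nu f).
move=> Fi.
have : nbhs (mu : Wi) 
      [set nu : signed_measure S | `|pairing mu f - pairing nu f| < delta].
  have := @initial_continuous (signed_measure S) R
    (fun nu : signed_measure S => pairing nu f) mu.
  by move=> /cvgrPdist_lt/(_ _ d0).
move=> /Fi; apply: filterS => nu /=.
by rewrite pairing_csub//; exact: BL_bounded_measurable.
Qed.

(** Concentration leaves only the behaviour on a thickened compact set, and
    there all functions of the unit ball are uniformly approximated by
    combinations of finitely many fixed functions. *)
Lemma near_dual_norm (rho : R) mu (e : R) : separable S -> 0 < rho ->
  tv_sphere S rho mu -> 0 < e ->
  \forall nu \near (mu : weak_measures S),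
    tv_sphere S rho nu -> BL_dual_norm (csub mu nu) < e.
Proof.
move=> sepS rho0 muM e0.
have tvM nu : tv_sphere S rho nu -> tvr nu setT = rho.
  by rewrite /tv_sphere/tvr/= => ->.
have e160 : 0 < e / 16 by rewrite divr_gt0.
have [n [K [n0 hK muK [lam0 [/andP[l00 _] hlam]]]]] :=
  concentration sepS rho0 muM e160.
(* The error budget: [e / 4] for the interpolant, and for each of [mu] and [nu]
   at most [4 * lam * rho + 2 * (e / 16) <= e / 4] for the remainder, which is
   bounded by [4 * lam] on the thickening and by 2 elsewhere. *)
pose lam := Num.min lam0 (e / (32 * rho)).
have l0 : 0 < lam by rewrite lt_min l00 divr_gt0// mulr_gt0.
have lrho : lam * rho <= e / 32.
  have : lam <= e / (32 * rho) by rewrite ge_min lexx orbT.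
  by rewrite ler_pdivlMr ?mulr_gt0//; lra.
have [delta [d0 hnu]] : exists delta : 'I_n -> R, (forall i, 0 < delta i) /\
    forall nu : signed_measure S, tv_sphere S rho nu ->
    (forall i, `|pairing (csub mu nu) (hat lam (K i))| < delta i) ->
    (tv_measure nu (~` thickening (\bigcup_i K i) lam) < (e / 16)%:E)%E.
  by apply: hlam; rewrite l0 ge_min lexx.
have cK : compact (\bigcup_i K i).
  have -> : \bigcup_i K i = \big[setU/set0]_(i < n) K i.
    by rewrite -bigcup_seq; apply: eq_bigcupl; split=> i //= _; exact: mem_index_enum.
  by apply: bigsetU_compact => i _; case: (hK i).
have K0 : (\bigcup_i K i) !=set0.
  by case: (hK (Ordinal n0)) => -[x Kx] _; exists x, (Ordinal n0).
have [s hs] := compact_net cK l0.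
have envK x : thickening (\bigcup_i K i) lam x -> envelope lam s x = 1.
  move=> xK; have [|a Ka xa] := @dist_set_lt _ _ (\bigcup_i K i) x (2 * lam) K0.
    by move: xK; rewrite /thickening/=; lra.
  have [c cs ca] := hs a Ka; apply: (envelope1 l0 cs).
  have := metric_triangle c a x; rewrite (metric_sym a x); lra.
(* The weak neighbourhood must not depend on [f]: only the increments of the
   envelope are tested, and [f] enters through coefficients bounded by 1. *)
have near_interp t (d : R) : 0 < d -> \forall nu \near (mu : weak_measures S),
    forall f, (forall x, `|f x| <= 1) ->
    `|pairing (csub mu nu) (interpolant lam f t)| <= (size t)%:R * d.
  move=> dd0; elim: t => [|c t IH].
    by near=> nu => f _; rewrite [interpolant _ _ _]/= pairing0 normr0 mul0r.
  have bi : BL (fun x => envelope lam (c :: t) x - envelope lam t x).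
    by apply: BLB; exact: BL_envelope.
  near=> nu.
  have IHnu : forall f, (forall x, `|f x| <= 1) ->
      `|pairing (csub mu nu) (interpolant lam f t)| <= (size t)%:R * d.
    by near: nu; exact: IH.
  move=> f f1.
  rewrite [interpolant _ _ _]/= -/(envelope lam (c :: t)).
  rewrite pairingD; [|exact/BL_bounded_measurable/BLZ|
    exact/BL_bounded_measurable/BL_interpolant].
  rewrite pairingZ; last exact: BL_bounded_measurable.
  have h1 : `|pairing (csub mu nu)
      (fun x => envelope lam (c :: t) x - envelope lam t x)| < d.
    by near: nu; exact: near_weak.
  have h2 : `|pairing (csub mu nu) (interpolant lam f t)| <= (size t)%:R * d.
    exact: IHnu.
  have -> : (size (c :: t))%:R * d = d + (size t)%:R * d.
    by rewrite /= -natr1; lra.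
  rewrite (le_trans (ler_normD _ _))// lerD//.
  by rewrite normrM (le_trans _ (ltW h1))// ler_piMl.
pose d := e / (4 * (size s).+1%:R).
have dd0 : 0 < d by rewrite divr_gt0// mulr_gt0.
have sd : (size s)%:R * d <= e / 4.
  rewrite /d mulrA ler_pdivrMr ?mulr_gt0// -(natr1 (size s)).
  have : 0 <= (size s)%:R :> R by rewrite ler0n.
  nra.
near=> nu => nuM.
have hat_small : forall i, `|pairing (csub mu nu) (hat lam (K i))| < delta i.
  near: nu; apply: filter_forall => i.
  by apply: near_weak => //; apply: BL_hat => //; case: (hK i).
have interp_small : forall f, (forall x, `|f x| <= 1) ->
    `|pairing (csub mu nu) (interpolant lam f s)| <= (size s)%:R * d.
  by near: nu; exact: near_interp.
pose T := thickening (\bigcup_i K i) lam.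
have mT : measurable (T : set (borel S)).
  by apply: closed_measurable_borel; exact: closed_thickening.
have mKK : measurable (\bigcup_i K i : set (borel S)).
  exact: compact_measurable_borel.
have nuT : tvr nu (~` T) < e / 16.
  by rewrite -lte_fin tvrK; [exact: hnu|exact: measurableC].
have muT : tvr mu (~` T) < e / 16.
  have h : tvr mu (~` \bigcup_i K i) < e / 16.
    by rewrite -lte_fin tvrK//; exact: measurableC.
  apply: le_lt_trans h; apply: le_tvr; [exact: measurableC..|].
  by apply: subsetC => x Kx; rewrite /T/thickening/= dist_set_mem// ltW.
apply: (@le_lt_trans _ _ (3 / 4 * e)); last by lra.
apply: BL_dual_norm_le; first by lra.
move=> f bf /(BL_norm_le1 bf)[f1 fL].
have bmf := BL_bounded_measurable bf.
have bmi := BL_bounded_measurable (BL_interpolant l0 f s).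
pose r x := f x - interpolant lam f s x.
have bmr : bounded_measurable (r : borel S -> R) := bounded_measurableB bmf bmi.
have r_small s' : tv_sphere S rho s' -> tvr s' (~` T) < e / 16 ->
    `|pairing s' r| <= e / 4.
  move=> s'M s'T.
  have := @pairing_le_split _ _ _ s' r T (4 * lam) 2 mT bmr.
  have := tvrC s' mT; rewrite tvM// => tvs'.
  have h0 := tvr_ge0 s' T; have h1 := tvr_ge0 s' (~` T).
  move=> h; apply: le_trans (h _ _) _.
  - move=> x Tx; have := interpolant_error l0 s x fL.
    by rewrite envK// !mulr1.
  - move=> x _; rewrite /r (le_trans (ler_normB _ _))//.
    have := interpolant_le lam s x f1; have := envelope_le1 l0 s x.
    have := f1 x; lra.
  - by nra.
have hr : pairing (csub mu nu) r = pairing mu r - pairing nu r.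
  exact: pairing_csub.
have hfi : pairing (csub mu nu) r = pairing (csub mu nu) f -
  pairing (csub mu nu) (interpolant lam f s) by exact: pairingB.
have := interp_small f f1; have := r_small _ muM muT; have := r_small _ nuM nuT.
rewrite !ler_norml; lra.
Unshelve. all: by end_near. Qed.

End topologies.
Section topologies_coincide.
Context (R : realType) (S : completeMetricType R).
Implicit Types (mu nu sigma : signed_measure S) (f : S -> R).

Lemma dual_openE (U : set (BL_dual_measures S)) : open U = BL_dual_open U.
Proof. by []. Qed.

Lemma pairing_dual_continuous f : BL f ->
  continuous ((fun mu => pairing mu f) : BL_dual_measures S -> R).
Proof.
move=> bf; apply/continuousP => C oC; rewrite dual_openE => mu Cmu.
have [[B fB] [L fL]] := bf.
have : nbhs (pairing mu f) C by exact: open_nbhs_nbhs.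
rewrite -filter_from_ballE => -[e /= e0 eC].
(* [c] scales [f] into the unit ball of the bounded Lipschitz norm. *)
pose c := (`|B| + `|L| + 1)^-1.
have s0 : 0 < `|B| + `|L| + 1.
  by have := normr_ge0 B; have := normr_ge0 L; lra.
have c0 : 0 < c by rewrite invr_gt0.
have bcf : BL (fun x => c * f x) by exact: BLZ.
have cf1 : BL_norm (fun x => c * f x) <= 1.
  apply: (@le_trans _ _ (c * `|B| + c * `|L|)).
    apply: BL_norm_le => [||x|x y]; rewrite ?mulr_ge0 ?(ltW c0)//.
      by rewrite normrM gtr0_norm// ler_wpM2l ?(ltW c0)// (le_trans (fB x))// ler_norm.
    rewrite -mulrBr normrM gtr0_norm// -mulrA ler_wpM2l ?(ltW c0)//.
    by rewrite (le_trans (fL x y))// ler_wpM2r ?mdist_ge0// ler_norm.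
  by rewrite -mulrDr mulrC ler_pdivrMr// mul1r lerDl.
exists (c * e); first by rewrite mulr_gt0.
move=> nu munu; apply: eC; rewrite /ball/=.
have := le_lt_trans (pairing_le_dual (csub mu nu) bcf cf1) munu.
have bmf := BL_bounded_measurable bf.
rewrite pairingZ// normrM gtr0_norm// ltr_pM2l//.
by rewrite pairing_csub.
Qed.

Lemma weak_open_dual_open (V : set (weak_measures S)) :
  open V -> open (V : set (BL_dual_measures S)).
Proof.
move=> oV; rewrite openE => mu Vmu; rewrite /interior.
pose F : set_system (signed_measure S) := nbhs (mu : BL_dual_measures S).
have FF : Filter F by exact: (@nbhs_filter (BL_dual_measures S) mu).
have Fw : F --> (mu : weak_measures S).
  apply/(cvg_sup _ _ FF) => i A.
  rewrite nbhsE => -[B [[C oC <-] Cmu] BA].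
  apply: (filterS BA).
  have bf : BL (\val i) by exact: (set_mem (valP i)).
  apply: (pairing_dual_continuous bf); exact: open_nbhs_nbhs.
by apply: Fw; exact: open_nbhs_nbhs.
Qed.

End topologies_coincide.

Theorem proposition3p2 (R : realType) (S : completeMetricType R)
    (S_separable : separable S) (rho : R) (rho_gt0 : 0 < rho) :
  (forall mu : signed_measure S, tv_sphere S rho mu ->
   forall eps : R, 0 < eps ->
   exists n : nat, exists K : 'I_n -> set S,
   [/\ (0 < n)%N,
       forall i, K i !=set0 /\ compact (K i),
       (tv_measure mu (~` \bigcup_i K i) < eps%:E)%E &
       exists lam0 : R, 0 < lam0 <= eps /\
         forall lam : R, 0 < lam <= lam0 ->
         exists delta : 'I_n -> R, (forall i, 0 < delta i) /\
           forall nu : signed_measure S, tv_sphere S rho nu ->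
           (forall i, `|pairing (csub mu nu) (hat lam (K i))| < delta i) ->
           (tv_measure nu (~` thickening (\bigcup_i K i) lam) < eps%:E)%E])
  /\
  (forall U : set (set_type (tv_sphere S rho)),
     relatively_open (weak_measures S) (tv_sphere S rho) U <->
     relatively_open (BL_dual_measures S) (tv_sphere S rho) U).
Proof.
split; first by move=> mu muM eps eps0; exact: concentration.
move=> U; split=> [[V oV VU]|[V oV <-]].
  by exists V => //; exact: weak_open_dual_open.
rewrite /relatively_open openE => -[mu muM] Vmu; rewrite /interior.
move: oV; rewrite dual_openE => /(_ _ Vmu)[e e0 eV].
have near_mu := near_dual_norm S_separable rho_gt0 (set_mem muM) e0.
pose M : topologicalType := set_type (tv_sphere S rho : set (weak_measures S)).
pose mu' : M := exist _ mu muM.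
have val_cont := @initial_continuous M (weak_measures S) set_val mu'.
apply: (@filterS _ _ (@nbhs_filter M mu') _ _ _ (val_cont _ near_mu)).
move=> [nu nuM] near_nu.
by apply: eV; apply: near_nu; exact: (set_mem nuM).
Qed.
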